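(* Let $\ell$ be a prime number and $q$ a prime power with $\ell\mid q-1$. Then $$\sum_{A,B\in\mathbb{F}_q^\times}a_{q,\ell}(A,B)^k=\begin{cases}0 & \text{if } k=1,\\ q(q-1)^2(\ell-1)(\ell-2) & \text{if } k=2.\end{cases}$$
   Context: $\mathbb{F}_q$ is the finite field with $q$ elements. For $A,B\in\mathbb{F}_q^\times$, let $N_{q,\ell}(A,B)$ be the number of $\mathbb{F}_q$-rational points on the projective plane curve $Ax^\ell+By^\ell=z^\ell$ in $\mathbb{P}^2_{\mathbb{F}_q}$, i.e. the number of points $[x:y:z]\in\mathbb{P}^2(\mathbb{F}_q)$ satisfying this equation, and put $$a_{q,\ell}(A,B):=N_{q,\ell}(A,B)-(q+1).$$ The sum is over all pairs $(A,B)\in\mathbb{F}_q^\times\times\mathbb{F}_q^\times$. *)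

(* Defs.v *)
From mathcomp Require Import all_boot all_order all_algebra all_field.

Set Implicit Arguments.
Unset Strict Implicit.
Unset Printing Implicit Defensive.

Import GRing.Theory.
Local Open Scope ring_scope.

Section ProjectivePlaneCurve.
Variable F : finFieldType.

Definition proj_point (v : 'rV[F]_3) : {set 'rV[F]_3} :=
  [set a *: v | a : F & a != 0].

Definition proj_plane : {set {set 'rV[F]_3}} :=
  [set proj_point v | v : 'rV[F]_3 & v != 0].

Definition on_fermat (l : nat) (A B : F) (v : 'rV[F]_3) : bool :=
  let x := v 0 0 in let y := v 0 1 in let z := v 0 2 in
  A * x ^+ l + B * y ^+ l == z ^+ l.

(* The equation is homogeneous, so asking it of every homogeneous coordinate
   vector of P amounts to asking it of one of them. *)
Definition fermat_curve (l : nat) (A B : F) : {set {set 'rV[F]_3}} :=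
  [set P in proj_plane | [forall v in P, on_fermat l A B v]].

Definition curve_count (l : nat) (A B : F) : nat := #|fermat_curve l A B|.

Definition curve_defect (l : nat) (A B : F) : int :=
  (curve_count l A B)%:Z - (#|F|.+1)%:Z.

End ProjectivePlaneCurve.

(* Main.v *)
Require Import Defs.
From mathcomp Require Import all_boot all_order all_algebra all_field.
From mathcomp Require Import cyclic ring.

Set Implicit Arguments.
Unset Strict Implicit.
Unset Printing Implicit Defensive.

Import GRing.Theory.
Local Open Scope ring_scope.

(** Write e(c) for the number of l-th roots of c in F, minus one; this is the
    sum of the nontrivial multiplicative characters of F of order dividing l,
    so that e(0) = 0.  All that is needed about it is elementary:
    - it sums to 0 over F ([root_excess_sum0]);
    - it reproduces itself under multiplicative correlation,
      sum_c e(a c) e(b c) = (q - 1) e(b / a) ([root_excess_corr]), an echo of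
      the orthogonality of characters;
    - e(1) = l - 1, because l divides q - 1 ([root_excess1]).

    Counting the points of the curve by the values s = A x^l and 1 - s = B y^l
    replaces the count by a sum of products of e + 1; since e has mean 0 the
    constant terms add up to q + 1 and the defect becomes
      a(A, B) = e(- B / A) + sum_s e(s / A) e((1 - s) / B),
    the first term coming from the points at infinity ([curve_defectE]).  After
    inverting A and B this is [defect_form], which vanishes when A or B is 0, so
    both moments are sums over all of F * F ([sum_units_inv]).

    The first moment is 0 because each term is already 0 once summed over A.
    For the second, expand the square.  Summing over A and B first, each double
    sum collapses under the correlation identity, leaving with m = q - 1:
    - m^2 e(1) for the square of the term at infinity;
    - - m^2 e(1) for its product with the sum over s, taken twice;
    - m^2 (q e(1)^2 - m e(1)) for the square of the sum over s, which rests on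
      the evaluation of sum_(s, t) e(t / s) e((1 - t) / (1 - s)) in
      [sum_excess_ratios].
    The total is m^2 q e(1) (e(1) - 1), where e(1) = l - 1. *)

(** * Projective points and affine charts *)

Section ChartCount.
Variables (F : finFieldType) (l : nat).

(** Normal forms [x : y : 1] and [x : 1 : 0] of the projective points other
    than [1 : 0 : 0], which lies on no curve A x^l + B y^l = z^l with A
    and l nonzero. *)
Definition chart_vector (p : F * F + F) : 'rV[F]_3 :=
  match p with
  | inl (x, y) => \row_(i < 3) [:: x; y; 1]`_i
  | inr x => \row_(i < 3) [:: x; 1; 0]`_i
  end.

Definition chart_equation (A B : F) (p : F * F + F) : bool :=
  match p with
  | inl (x, y) => A * x ^+ l + B * y ^+ l == 1
  | inr x => A * x ^+ l + B == 0
  end.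

Lemma on_fermat_chart (A B : F) (p : F * F + F) :
  (0 < l)%N -> on_fermat l A B (chart_vector p) = chart_equation A B p.
Proof.
move=> l_gt0; case: p => [[x y]|x]; rewrite /on_fermat !mxE /= !expr1n //.
by rewrite mulr1 expr0n eqn0Ngt l_gt0.
Qed.

Lemma on_fermatZ (A B a : F) (v : 'rV[F]_3) :
  a != 0 -> on_fermat l A B (a *: v) = on_fermat l A B v.
Proof.
move=> a0; rewrite /on_fermat !mxE !exprMn.
have -> u w : A * (a ^+ l * u) + B * (a ^+ l * w) = a ^+ l * (A * u + B * w).
  by ring.
exact: inj_eq (mulfI (expf_neq0 l a0)) _ _.
Qed.

Lemma mem_proj_point (v : 'rV[F]_3) : v \in proj_point v.
Proof. by apply/imsetP; exists 1; rewrite ?scale1r // inE oner_eq0. Qed.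

Lemma proj_pointZ (a : F) (v : 'rV[F]_3) :
  a != 0 -> proj_point (a *: v) = proj_point v.
Proof.
move=> a0; apply/setP=> w; apply/imsetP/imsetP=> -[b]; rewrite inE => b0 ->.
  by exists (b * a); rewrite ?scalerA // inE mulf_neq0.
by exists (b / a); rewrite ?scalerA ?divfK // inE mulf_neq0 ?invr_eq0.
Qed.

(** Two normal forms on the same line through the origin differ by a scalar,
    which their last nonzero coordinate, equal to 1, forces to be 1. *)
Lemma proj_chart_inj : injective (fun p => proj_point (chart_vector p)).
Proof.
move=> p p' /= E; have := mem_proj_point (chart_vector p).
rewrite E => /imsetP [a _ /rowP Ev].
have := Ev 0; have := Ev 1; have := Ev 2.
case: p {E Ev} => [[x y]|x]; case: p' => [[x' y']|x'];
  rewrite !mxE /= ?mulr1 ?mulr0.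
- by move=> <- -> ->; rewrite !mul1r.
- by move/eqP; rewrite oner_eq0.
- by move=> <- /eqP; rewrite mul0r oner_eq0.
- by move=> _ <- ->; rewrite mul1r.
Qed.

Lemma chart_vector_neq0 p : chart_vector p != 0.
Proof.
case: p => [[x y]|x]; apply/eqP=> /rowP E.
- by have := E 2; rewrite !mxE /= => /eqP; rewrite oner_eq0.
- by have := E 1; rewrite !mxE /= => /eqP; rewrite oner_eq0.
Qed.

Lemma on_fermat_chart_exists (A B : F) (v : 'rV[F]_3) :
    (0 < l)%N -> A != 0 -> v != 0 -> on_fermat l A B v ->
  exists2 a, a != 0 & exists p, v = a *: chart_vector p.
Proof.
move=> l_gt0 A0 v0 ev.
have vE : v = \row_(i < 3) [:: v 0 0; v 0 1; v 0 2]`_i.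
  apply/rowP=> i; rewrite mxE; case: i => [[|[|[|//]]] lti] /=;
    by congr (v 0 _); exact: val_inj.
have [z0|z0] := eqVneq (v 0 2) 0; last first.
  exists (v 0 2) => //.
  exists (inl (v 0 0 / v 0 2, v 0 1 / v 0 2)).
  rewrite {1}vE; apply/rowP=> i; rewrite !mxE.
  by case: i => [[|[|[|//]]] lti] /=; rewrite ?mulr1 // mulrC divfK.
have [y0|y0] := eqVneq (v 0 1) 0; last first.
  exists (v 0 1) => //; exists (inr (v 0 0 / v 0 1)).
  rewrite {1}vE; apply/rowP=> i; rewrite !mxE.
  by case: i => [[|[|[|//]]] lti] /=; rewrite ?mulr1 ?mulr0 // mulrC divfK.
(* With y = z = 0 the equation reads A x^l = 0, whence v = 0. *)
case/negP: v0; apply/eqP; rewrite vE y0 z0.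
have -> : v 0 0 = 0.
  move: ev; rewrite /on_fermat y0.
  rewrite z0 !expr0n eqn0Ngt l_gt0 mulr0 addr0 mulf_eq0 (negPf A0) /=.
  by rewrite expf_eq0 l_gt0 => /eqP.
by apply/rowP=> i; rewrite !mxE; case: i => [[|[|[|//]]] lti].
Qed.

Lemma curve_count_chart (A B : F) :
  (0 < l)%N -> A != 0 -> curve_count l A B = #|chart_equation A B|.
Proof.
move=> l_gt0 A0.
rewrite -(card_imset (chart_equation A B) proj_chart_inj) /curve_count.
apply: eq_card => P; rewrite inE; apply/andP/imsetP.
- case=> /imsetP [v]; rewrite inE => v0 -> /forall_inP onP.
  have onv := onP _ (mem_proj_point v).
  have [a a0 [p vE]] := on_fermat_chart_exists l_gt0 A0 v0 onv.
  exists p; last by rewrite vE proj_pointZ.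
  by rewrite -topredE /= -on_fermat_chart // -(on_fermatZ A B _ a0) -vE.
- case=> p onp ->; split.
    by apply/imsetP; exists (chart_vector p); rewrite ?inE ?chart_vector_neq0.
  apply/forall_inP=> w /imsetP [a]; rewrite inE => a0 ->.
  by rewrite on_fermatZ // on_fermat_chart.
Qed.

End ChartCount.

(** * The root excess function *)

Section RootExcess.
Variables (F : finFieldType) (l : nat).

Definition root_excess (c : F) : int := #|[set x : F | x ^+ l == c]|%:Z - 1.

Local Notation e := root_excess.
Local Notation q := (#|F|%:Z).

Lemma root_excessE c : e c + 1 = \sum_x (x ^+ l == c)%:Z.
Proof.
rewrite /e subrK -sum1dep_card -natz natr_sum big_mkcond /=.
by apply: eq_bigr => x _; case: eqP.
Qed.

(** Fibering F over the l-th power map: this is how counts of points turn into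
    sums of e + 1. *)
Lemma sum_root_excess (f : F -> int) :
  \sum_c (e c + 1) * f c = \sum_x f (x ^+ l).
Proof.
under eq_bigr => c _ do rewrite root_excessE mulr_suml.
rewrite exchange_big; apply: eq_bigr => x _ /=.
rewrite (bigD1 (x ^+ l)) //= eqxx mul1r big1 ?addr0 // => c.
by rewrite eq_sym => /negPf->; rewrite mul0r.
Qed.

Lemma root_excess_sum0 : \sum_c e c = 0.
Proof.
have := sum_root_excess (fun=> 1).
under eq_bigr do rewrite mulr1.
by rewrite big_split /= -[RHS]add0r => /addIr.
Qed.

Lemma root_excess0 : (0 < l)%N -> e 0 = 0.
Proof.
move=> l_gt0; rewrite /e (_ : [set x | _] = [set 0]) ?cards1 //.
by apply/setP=> x; rewrite !inE expf_eq0 l_gt0.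
Qed.

Lemma root_excessM c x : x != 0 -> e (c * x ^+ l) = e c.
Proof.
move=> x0; apply: (addIr 1); rewrite !root_excessE.
rewrite (reindex_inj (mulIf x0)); apply: eq_bigr => y _ /=.
by rewrite exprMn (inj_eq (mulIf (expf_neq0 l x0))).
Qed.

Lemma sum_scale (f : F -> int) a : a != 0 -> \sum_c f (c * a) = \sum_c f c.
Proof. by move=> a0; rewrite [RHS](reindex_inj (mulIf a0)). Qed.

Lemma sum_sub (f : F -> int) a : \sum_c f (a - c) = \sum_c f c.
Proof.
by rewrite [RHS](reindex_inj (inv_inj (subKr a))).
Qed.

Lemma sum_neq0_const (z : int) : \sum_(c : F | c != 0) z = (q - 1) * z.
Proof.
have q_gt0 : (0 < #|F|)%N by apply/card_gt0P; exists 0.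
rewrite sumr_const (_ : #|_| = #|F|.-1); last first.
  by rewrite -(cardC1 (0 : F)); apply: eq_card => x; rewrite !inE.
by rewrite -mulr_natl natz predn_int.
Qed.

Hypothesis l_gt0 : (0 < l)%N.

Lemma root_excess_sumM a : \sum_c e (a * c) = 0.
Proof.
have [->|a0] := eqVneq a 0.
  by rewrite big1 // => c _; rewrite mul0r root_excess0.
under eq_bigr do rewrite mulrC.
by rewrite (sum_scale e) // root_excess_sum0.
Qed.

(** After rescaling to a = 1, add the vanishing sum of the e(d c): the weight
    e(c) becomes e(c) + 1, and [sum_root_excess] turns the sum into that of
    e(d x^l), whose terms for x nonzero all equal e(d).  As e(0) = 0, the
    convention 1 / 0 = 0 makes the identity hold for a = 0 as well. *)
Lemma root_excess_corr a b :
  \sum_c e (a * c) * e (b * c) = (q - 1) * e (b / a).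
Proof.
have e0 := root_excess0 l_gt0.
have [->|a0] := eqVneq a 0.
  by rewrite invr0 mulr0 e0 mulr0 big1 // => c _; rewrite mul0r e0 mul0r.
rewrite (eq_bigr (fun c => e (c * a) * e (b / a * (c * a)))); last first.
  by move=> c _; rewrite [c * a]mulrC mulrA divfK.
rewrite (sum_scale (fun c => e c * e (b / a * c))) //.
move: (b / a) => d {a b a0}.
have [->|d0] := eqVneq d 0.
  by rewrite e0 mulr0 big1 // => c _; rewrite mul0r e0 mulr0.
transitivity (\sum_c (e c + 1) * e (d * c)).
  under [RHS]eq_bigr => c _ do rewrite mulrDl mul1r.
  by rewrite big_split /= root_excess_sumM addr0.
rewrite (sum_root_excess (fun c => e (d * c))).
rewrite (bigD1 0) //= expr0n eqn0Ngt l_gt0 mulr0 e0 add0r.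
rewrite (eq_bigr (fun=> e d)) => [|x x0]; last exact: root_excessM.
exact: sum_neq0_const.
Qed.

(** The nonzero elements of F are q - 1 roots of X^(q - 1) - 1, so F has a
    primitive (q - 1)-st root of unity and hence a primitive l-th one, whose
    powers are exactly the l-th roots of 1. *)
Lemma root_excess1 : (l %| #|F| - 1)%N -> e 1 = l%:Z - 1.
Proof.
move=> ldvd; congr (_%:Z - 1).
have q1_gt0 : (0 < #|F| - 1)%N by rewrite subn_gt0 finRing_gt1.
have [z z_prim] : exists z : F, (#|F| - 1).-primitive_root z.
  pose U := enum (predC1 (0 : F)).
  have /hasP[z _ z_prim] : has (#|F| - 1).-primitive_root U;
    last by exists z.
  apply: has_prim_root => //; rewrite ?enum_uniq //; last first.
    by rewrite -cardE cardC1 subn1.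
  apply/allP=> x; rewrite mem_enum inE => x0; apply/unity_rootP.
  apply: (mulfI x0); rewrite -exprS subn1 prednK ?expf_card ?mulr1 //.
  by apply/card_gt0P; exists 0.
have w_prim := dvdn_prim_root z_prim ldvd.
set w := z ^+ _ in w_prim.
have inj_w : injective (fun i : 'I_l => w ^+ i).
  move=> i j /eqP; rewrite (eq_prim_root_expr w_prim) !modn_small //.
  by move/eqP/val_inj.
rewrite -[RHS]card_ord -(card_imset _ inj_w); apply: eq_card => x.
rewrite inE; apply/eqP/imsetP=> [/(prim_rootP w_prim) [i ->]|[i _ ->]].
  by exists i.
by rewrite exprAC (prim_expr_order w_prim) expr1n.
Qed.

(** * Moments of the defect form *)

(** When A = B = 1 this is the sum of the Jacobi sums J(chi, psi) over pairs of
    nontrivial characters of order dividing l. *)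
Definition jacobi_sum (A B : F) : int := \sum_s e (s * A) * e ((1 - s) * B).

(** The defect of the curve with coefficients 1 / A and 1 / B; inverting the
    coefficients lets A and B range over the whole field. *)
Definition defect_form (A B : F) : int := e (- A / B) + jacobi_sum A B.

Lemma defect_form0l B : defect_form 0 B = 0.
Proof.
rewrite /defect_form /jacobi_sum oppr0 mul0r root_excess0 // add0r.
by rewrite big1 // => s _; rewrite mulr0 root_excess0 // mul0r.
Qed.

Lemma defect_form0r A : defect_form A 0 = 0.
Proof.
rewrite /defect_form /jacobi_sum invr0 mulr0 root_excess0 // add0r.
by rewrite big1 // => s _; rewrite mulr0 root_excess0 // mulr0.
Qed.

Lemma sum_defect_form B : \sum_A defect_form A B = 0.
Proof.
rewrite big_split /=.
under eq_bigr do rewrite mulNr mulrC -mulNr.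
rewrite root_excess_sumM exchange_big add0r big1 // => s _.
by rewrite -mulr_suml root_excess_sumM mul0r.
Qed.

Lemma sum_sqr_infinity :
  \sum_A \sum_B e (- A / B) ^+ 2 = (q - 1) ^+ 2 * e 1.
Proof.
rewrite exchange_big /=.
transitivity (\sum_B (q - 1) * e (B^-1 * B)).
  apply: eq_bigr => B _.
  under eq_bigr do rewrite mulNr mulrC -mulNr expr2.
  by rewrite root_excess_corr invrN mulrNN invrK.
have e_one B : B != 0 -> e (B^-1 * B) = e 1 by move=> B0; rewrite mulVf.
rewrite -mulr_sumr (bigD1 0) //= mulr0 root_excess0 // add0r.
by rewrite (eq_bigr _ e_one) sum_neq0_const; ring.
Qed.

(** Correlating over A, then over B, leaves the sum of e((1 - s) / - s), that is
    of e(1 - 1 / s) over s nonzero: a complete sum deprived of its value at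
    1. *)
Lemma sum_infinity_jacobi :
  \sum_A \sum_B e (- A / B) * jacobi_sum A B = - (q - 1) ^+ 2 * e 1.
Proof.
transitivity (\sum_s \sum_B
    e ((1 - s) * B) * \sum_A e (- B^-1 * A) * e (s * A)).
  under eq_bigr => A _ do under eq_bigr => B _ do rewrite mulr_sumr.
  under eq_bigr => A _ do rewrite exchange_big /=.
  rewrite exchange_big /=; apply: eq_bigr => s _.
  rewrite exchange_big /=; apply: eq_bigr => B _.
  rewrite mulr_sumr; apply: eq_bigr => A _.
  by rewrite mulNr [A / B]mulrC -mulNr; ring.
transitivity (\sum_s (q - 1) ^+ 2 * e ((1 - s) / - s)).
  apply: eq_bigr => s _.
  rewrite expr2 -mulrA -root_excess_corr mulr_sumr; apply: eq_bigr => B _.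
  by rewrite root_excess_corr invrN invrK mulrN mulNr; ring.
have sum_all : \sum_s e (1 - s^-1) = 0.
  rewrite -(reindex_inj (P := xpredT) (F := fun s => e (1 - s)) (@invr_inj F)).
  by rewrite (sum_sub e) root_excess_sum0.
rewrite -mulr_sumr mulNr -mulrN; congr (_ * _).
rewrite (bigD1 0) //= oppr0 invr0 mulr0 root_excess0 // add0r.
move: sum_all; rewrite (bigD1 0) //= invr0 subr0 => /eqP.
rewrite addrC addr_eq0 => /eqP <-; apply: eq_bigr => s s0; congr e.
by field; rewrite ?oppr_eq0 s0.
Qed.

(** The rows s = 0 and s = 1 vanish.  On the others put t = u s: the second
    ratio becomes u + (1 - u) / (1 - s), and for fixed u the element 1 / (1 - s)
    runs over everything but 1 and 0.  The inner sum is thus a sum over all of F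
    less the two terms e(u) and e(1); that full sum is q e(1) when u = 1, and
    otherwise vanishes, its argument being an affine reparametrization of F. *)
Lemma sum_excess_ratios :
  \sum_s \sum_t e (t / s) * e ((1 - t) / (1 - s)) =
  q * e 1 ^+ 2 - (q - 1) * e 1.
Proof.
have e0 := root_excess0 l_gt0.
have inner u : \sum_(s | (s != 0) && (s != 1)) e (u + (1 - u) / (1 - s)) =
    (u == 1)%:Z * (q * e 1) - e u - e 1.
  have inj_h : injective (fun s : F => (1 - s)^-1).
    by move=> s t /invr_inj/(inv_inj (subKr 1)).
  have : \sum_s e (u + (1 - u) / (1 - s)) = (u == 1)%:Z * (q * e 1).
    pose H w := e (u + (1 - u) * w).
    rewrite -(reindex_inj (P := xpredT) (F := H) inj_h) /H.
    have [->|u1] := eqVneq u 1.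
      under eq_bigr do rewrite subrr mul0r addr0.
      by rewrite sumr_const mul1r -mulr_natl natz.
    rewrite mul0r -[RHS](root_excess_sumM (1 - u)).
    (* u + (1 - u) w = (1 - u) (u / (1 - u) + w) *)
    rewrite [RHS](reindex_inj (addrI (u / (1 - u)))).
    apply: eq_bigr => w _; congr e; field.
    by rewrite subr_eq0 eq_sym.
  rewrite (bigD1 0) //= (bigD1 1) ?oner_neq0 //= => <-.
  rewrite subr0 divr1 subrr invr0 mulr0 addr0 [u + _]addrC subrK; ring.
transitivity (\sum_(s | (s != 0) && (s != 1))
    \sum_u e u * e (u + (1 - u) / (1 - s))).
  have row0 : \sum_t e (t / 0) * e ((1 - t) / (1 - 0)) = 0.
    by apply: big1 => t _; rewrite invr0 mulr0 e0 mul0r.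
  have row1 : \sum_t e (t / 1) * e ((1 - t) / (1 - 1)) = 0.
    by apply: big1 => t _; rewrite subrr invr0 mulr0 e0 mulr0.
  rewrite (bigD1 0) //= row0 add0r (bigD1 1) ?oner_neq0 //= row1 add0r.
  apply: eq_bigr => s /andP[s0 s1].
  rewrite -(sum_scale _ s0); apply: eq_bigr => u _; rewrite mulfK //.
  by congr (_ * e _); field; rewrite subr_eq0 eq_sym.
rewrite exchange_big /=.
transitivity (\sum_u (e u * (u == 1)%:Z * (q * e 1) - e u * e u - e u * e 1)).
  by apply: eq_bigr => u _; rewrite -mulr_sumr inner; ring.
rewrite big_split big_split /= !sumrN -!mulr_suml root_excess_sum0 mul0r subr0.
have := root_excess_corr 1 1; rewrite divr1.
under eq_bigr do rewrite mul1r.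
move=> ->; rewrite (bigD1 1) //= big1 => [|u /negPf->]; last by rewrite mulr0.
rewrite eqxx mulr1; ring.
Qed.

(** For each pair (s, t) the sum over A and B factors into two correlations. *)
Lemma sum_sqr_jacobi :
  \sum_A \sum_B jacobi_sum A B ^+ 2 =
  (q - 1) ^+ 2 * (q * e 1 ^+ 2 - (q - 1) * e 1).
Proof.
rewrite -sum_excess_ratios.
transitivity (\sum_s \sum_t (\sum_A e (s * A) * e (t * A)) *
                (\sum_B e ((1 - s) * B) * e ((1 - t) * B))).
  under eq_bigr => A _ do under eq_bigr => B _ do rewrite expr2 big_distrlr.
  rewrite /=.
  under eq_bigr => A _ do rewrite exchange_big /=.
  rewrite exchange_big /=; apply: eq_bigr => s _.
  under eq_bigr => A _ do rewrite exchange_big /=.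
  rewrite exchange_big /=; apply: eq_bigr => t _.
  rewrite mulr_suml; apply: eq_bigr => A _.
  by rewrite mulr_sumr; apply: eq_bigr => B _; ring.
rewrite mulr_sumr; apply: eq_bigr => s _; rewrite mulr_sumr.
by apply: eq_bigr => t _; rewrite !root_excess_corr; ring.
Qed.

Lemma sum_sqr_defect_form :
  \sum_A \sum_B defect_form A B ^+ 2 = q * (q - 1) ^+ 2 * e 1 * (e 1 - 1).
Proof.
transitivity (\sum_A (\sum_B e (- A / B) ^+ 2 +
    \sum_B (e (- A / B) * jacobi_sum A B) *+ 2 +
    \sum_B jacobi_sum A B ^+ 2)).
  apply: eq_bigr => A _; rewrite -!big_split; apply: eq_bigr => B _.
  by rewrite sqrrD.
rewrite !big_split /= sum_sqr_infinity sum_sqr_jacobi.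
under [X in _ + X + _]eq_bigr do rewrite sumrMnl.
by rewrite sumrMnl sum_infinity_jacobi; ring.
Qed.

(** * The defect of the curve *)

(** For fixed x the number of y is e((1 - A x^l) / B) + 1; regrouping the x by
    s = A x^l gives the sum of (e(s / A) + 1) (e((1 - s) / B) + 1), and the
    linear terms vanish on summation. *)
Lemma affine_count A B : A != 0 -> B != 0 ->
  \sum_x \sum_y (A * x ^+ l + B * y ^+ l == 1)%:Z =
  q + jacobi_sum A^-1 B^-1.
Proof.
move=> A0 B0.
transitivity (\sum_x (e ((1 - A * x ^+ l) / B) + 1)).
  apply: eq_bigr => x _; rewrite root_excessE; apply: eq_bigr => y _.
  by congr (Posz (nat_of_bool _)); apply/eqP/eqP => [<-|->]; field.
rewrite -(sum_root_excess (fun c => e ((1 - A * c) / B) + 1)).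
have A'0 : A^-1 != 0 by rewrite invr_eq0.
rewrite -(sum_scale _ A'0).
under eq_bigr => s _ do
  rewrite [A * _]mulrC divfK // mulrDl mul1r mulrDr mulr1 -addrA.
rewrite big_split addrC /= big_split /=.
rewrite (sum_scale e) // root_excess_sum0 add0r big_split /=.
rewrite (sum_sub (fun t => e (t / B))) (sum_scale e) ?invr_eq0 //.
by rewrite root_excess_sum0 add0r sumr_const natz addrC.
Qed.

Lemma curve_defectE A B : A != 0 -> B != 0 ->
  curve_defect l A B = defect_form A^-1 B^-1.
Proof.
move=> A0 B0; rewrite /curve_defect curve_count_chart //.
have -> : #|chart_equation l A B|%:Z =
    \sum_x \sum_y (A * x ^+ l + B * y ^+ l == 1)%:Z +
    \sum_x (A * x ^+ l + B == 0)%:Z.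
  rewrite -sum1_card -natz natr_sum big_mkcond big_sumType /=; congr (_ + _).
    rewrite pair_bigA; apply: eq_bigr => -[x y] _ /=.
    by rewrite -topredE /=; case: eqP.
  by apply: eq_bigr => x _; rewrite -topredE /=; case: eqP.
have -> : \sum_x (A * x ^+ l + B == 0)%:Z = e (- B / A) + 1.
  rewrite root_excessE; apply: eq_bigr => x _.
  congr (Posz (nat_of_bool _)); apply/eqP/eqP => [|->]; last by field.
  by move/eqP; rewrite addr_eq0 => /eqP <-; field.
by rewrite affine_count // /defect_form invrK !mulNr [A^-1 * B]mulrC intS; ring.
Qed.

Lemma sum_units_inv (g : F -> F -> int) :
    (forall B, g 0 B = 0) -> (forall A, g A 0 = 0) ->
  \sum_(A | A != 0) \sum_(B | B != 0) g A^-1 B^-1 = \sum_A \sum_B g A B.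
Proof.
move=> gl gr; rewrite [RHS](reindex_inj (@invr_inj F)) [RHS](bigD1 0) //=.
rewrite [X in _ = X + _]big1 => [|B _]; last by rewrite invr0 gl.
rewrite add0r; apply: eq_bigr => A _.
rewrite [RHS](reindex_inj (@invr_inj F)) [RHS](bigD1 0) //=.
by rewrite invr0 gr add0r.
Qed.

End RootExcess.

Theorem lemma3 (F : finFieldType) (q l : nat) (hq : #|F| = q)
    (hl : prime l) (hlq : (l %| q - 1)%N) :
  \sum_(A : F | A != 0) \sum_(B : F | B != 0) curve_defect l A B ^+ 1 = 0
  /\
  \sum_(A : F | A != 0) \sum_(B : F | B != 0) curve_defect l A B ^+ 2
    = q%:Z * (q%:Z - 1) ^+ 2 * (l%:Z - 1) * (l%:Z - 2).
Proof.
subst q; have l_gt0 := prime_gt0 hl.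
have moment k : (0 < k)%N ->
    \sum_(A : F | A != 0) \sum_(B : F | B != 0) curve_defect l A B ^+ k =
    \sum_A \sum_B @defect_form F l A B ^+ k.
  move=> k_gt0; rewrite -sum_units_inv => [||A]; first last.
  - by rewrite defect_form0r // expr0n eqn0Ngt k_gt0.
  - by move=> B; rewrite defect_form0l // expr0n eqn0Ngt k_gt0.
  apply: eq_bigr => A A0; apply: eq_bigr => B B0.
  by rewrite curve_defectE.
rewrite !moment //; split.
  by rewrite exchange_big big1 // => B _; exact: sum_defect_form.
by rewrite sum_sqr_defect_form // root_excess1 //; ring.
Qed.
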